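(* Let $1\le n\le7$, let $\Omega\subset\mathbb R^n$ be a bounded convex polyhedron, let $\alpha<0$, and let $\beta>\beta^*$, where $\beta^*=\sup_{R\ge1}\beta_0(\alpha,\Omega_R)$. Let $U_R$ be a ridge-Nehari solution in $\Omega_R$. Then the energy $E[U_R]$ is uniformly bounded with respect to $R\ge1$.
   Context: $\Omega_R=\{Rx: x\in\Omega\}$, $R\ge1$. For a bounded convex polyhedron $G\subset\mathbb R^n$ let $\mathcal W(G)=\{v\in W_2^2(G):\ \partial v/\partial\mathbf n=0\text{ on }\partial G\}$, and for $u\in\mathcal W(G)$ put $Q[u]=\int_G\big((\Delta u+u)^2-\alpha u^2\big)dx$, $E[u]=\frac12Q[u]-\frac\beta3\int_Gu^3dx+\frac14\int_Gu^4dx$, $L[u]=Q[u]-\beta\int_Gu^3dx+\int_Gu^4dx$, $H[u]=2Q[u]-3\beta\int_Gu^3dx+4\int_Gu^4dx$. For $m=3,4$, $S_m(G)=\inf\{Q[u]^{1/2}|\int_Gu^mdx|^{-1/m}:u\in\mathcal W(G),\ \int_Gu^mdx\ne0\}$, and $\beta_0(\alpha,G)=2\max\{\sqrt{1-\alpha},\ S_3(G)^3S_4(G)^{-2}\}$. For fixed $\Omega$ and $\alpha$ one has $\beta^*<\infty$. For $\beta>\beta_0(\alpha,G)$ a ridge-Nehari solution in $G$ is a minimizer of $E$ on the set $\{v\in\mathcal W(G)\setminus\{0\}:L[v]=0,\ H[v]\le0\}$; such minimizers exist. The energy $E[U_R]$ is computed with $G=\Omega_R$. *)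

(* Defs.v *)
From HB Require Import structures.
From mathcomp Require Import all_boot all_order all_algebra.
From mathcomp Require Import all_classical all_reals all_analysis.
Set Implicit Arguments.
Unset Strict Implicit.
Unset Printing Implicit Defensive.
Import Order.TTheory GRing.Theory Num.Theory.
Import numFieldNormedType.Exports.
Local Open Scope classical_set_scope.
Local Open Scope ring_scope.

Definition rV_display : measure_display -> measure_display.
Proof. exact. Qed.

Section measurable_rV.
Context (R : realType) (n : nat).

Definition rV_coor (i : 'I_n) (x : 'rV[R]_n) : measurableTypeR R := x 0 i.

Let rV_set0 : g_sigma_preimage rV_coor set0.
Proof. exact: sigma_algebra0. Qed.

Let rV_setC A : g_sigma_preimage rV_coor A -> g_sigma_preimage rV_coor (~` A).
Proof. exact: sigma_algebraC. Qed.

Let rV_bigcup (F : (set 'rV[R]_n)^nat) :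
  (forall i, g_sigma_preimage rV_coor (F i)) ->
  g_sigma_preimage rV_coor (\bigcup_i (F i)).
Proof. exact: sigma_algebra_bigcup. Qed.

HB.instance Definition _ := @isMeasurable.Build (rV_display default_measure_display)
  'rV[R]_n (g_sigma_preimage rV_coor) rV_set0 rV_setC rV_bigcup.
End measurable_rV.

Section rV_measurability.
Context (R : realType).

Lemma measurable_rV_coor n (i : 'I_n) :
  measurable_fun [set: 'rV[R]_n] (rV_coor i).
Proof.
move=> _ Y mY; rewrite setTI; apply: sub_sigma_algebra => /=.
rewrite -bigcup_seq/=; exists i => /=; first by rewrite mem_index_enum.
by exists Y => //; rewrite setTI.
Qed.

Lemma measurable_fun_rV d (T : measurableType d) n (f : T -> 'rV[R]_n) :
  (forall i, measurable_fun [set: T] (rV_coor i \o f)) ->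
  measurable_fun [set: T] f.
Proof.
move=> mf.
have sub : g_sigma_preimage (fun i => rV_coor i \o f) `<=` measurable.
  apply: smallest_sub; first exact: sigma_algebra_measurable.
  case: n => [|n] in f mf *; first by rewrite big_ord0.
  rewrite -bigcup_mkord_ord; apply: bigcup_sub => i Ii.
  by move=> A [B mB <-]; exact: mf.
rewrite g_sigma_preimage_comp in sub.
by move=> _ A mA; apply: sub; exists A.
Qed.

Definition rV_cons n (p : measurableTypeR R * 'rV[R]_n) : 'rV[R]_n.+1 :=
  \row_i if unlift ord0 i is Some j then p.2 0 j else p.1.

Lemma measurable_rV_cons n : measurable_fun setT (@rV_cons n).
Proof.
apply: measurable_fun_rV => i; case: (unliftP ord0 i) => [j ->|->].
  rewrite (_ : _ \o _ = rV_coor j \o snd); last first.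
    by apply/funext => p; rewrite /rV_coor /= mxE liftK.
  by apply: measurableT_comp => //; exact: measurable_rV_coor.
rewrite (_ : _ \o _ = fst) //.
by apply/funext => p; rewrite /rV_coor /= mxE unlift_none.
Qed.

Definition rV_uncons n (x : 'rV[R]_n.+1) : measurableTypeR R * 'rV[R]_n :=
  (x 0 ord0, \row_j x 0 (lift ord0 j)).

Lemma rV_consK n : cancel (@rV_cons n) (@rV_uncons n).
Proof.
move=> [a y]; rewrite /rV_uncons mxE unlift_none/=; congr pair.
by apply/rowP => j; rewrite !mxE liftK.
Qed.

Lemma measurable_rV_uncons n : measurable_fun setT (@rV_uncons n).
Proof.
apply/measurable_fun_pair => /=; first exact: (@measurable_rV_coor n.+1 ord0).
apply: measurable_fun_rV => j.
rewrite (_ : _ \o _ = rV_coor (lift ord0 j)); first exact: measurable_rV_coor.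
by apply/funext => x; rewrite /rV_coor /= mxE.
Qed.

End rV_measurability.

Section lebesgue_rV_step.
Context (R : realType) (n : nat).
Variable m : {sigma_finite_measure set 'rV[R]_n -> \bar R}.
Local Open Scope ereal_scope.

Definition lebesgue_rV_step : set 'rV[R]_n.+1 -> \bar R :=
  pushforward (lebesgue_measure \x m) (@rV_cons R n).

Let rV_cons_preimage A : measurable A -> measurable (@rV_cons R n @^-1` A).
Proof. by move=> mA; rewrite -[X in measurable X]setTI; exact: measurable_rV_cons. Qed.

Let step0 : lebesgue_rV_step set0 = 0.
Proof. by rewrite /lebesgue_rV_step /pushforward preimage_set0 measure0. Qed.

Let step_ge0 A : 0 <= lebesgue_rV_step A.
Proof. by rewrite /lebesgue_rV_step /pushforward; exact: measure_ge0. Qed.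

Let step_sigma_additive : semi_sigma_additive lebesgue_rV_step.
Proof.
move=> F mF tF mUF; rewrite /lebesgue_rV_step /pushforward preimage_bigcup.
apply: measure_semi_sigma_additive.
- by move=> k; exact: rV_cons_preimage.
- apply/trivIsetP => /= i j _ _ ij; rewrite -preimage_setI.
  by move/trivIsetP : tF => /(_ _ _ _ _ ij) ->//; rewrite preimage_set0.
- by rewrite -preimage_bigcup; exact: rV_cons_preimage.
Qed.

HB.instance Definition _ := isMeasure.Build _ _ _
  lebesgue_rV_step step0 step_ge0 step_sigma_additive.

Let step_sigma_finite : sigma_finite setT lebesgue_rV_step.
Proof.
have /sigma_finiteP[F [TF ndF Foo]] := sigma_finiteT (@lebesgue_measure R).
have /sigma_finiteP[G [TG ndG Goo]] := sigma_finiteT m.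
exists (fun k => @rV_uncons R n @^-1` (F k `*` G k)).
  apply/esym; rewrite -subTset => x _.
  have : [set: measurableTypeR R] (rV_uncons x).1 by [].
  have : [set: 'rV[R]_n] (rV_uncons x).2 by [].
  rewrite TF TG => -[j _ Gx] [i _ Fx]; exists (maxn i j) => //; split.
    by apply: (subsetPset _ _ (ndF _ _ (leq_maxl i j))).
  by apply: (subsetPset _ _ (ndG _ _ (leq_maxr i j))).
move=> k; have [mF Fk] := Foo k; have [mG Gk] := Goo k; split.
  rewrite -[X in measurable X]setTI; apply: measurable_rV_uncons => //.
  exact: measurableX.
rewrite /lebesgue_rV_step /pushforward -comp_preimage.
rewrite (_ : _ \o _ = id); last by apply/funext => p /=; rewrite rV_consK.
by rewrite preimage_id product_measure1E// lte_mul_pinfty// ge0_fin_numE.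
Qed.

HB.instance Definition _ := Measure_isSigmaFinite.Build _ _ _
  lebesgue_rV_step step_sigma_finite.
End lebesgue_rV_step.

Fixpoint lebesgue_rV (R : realType) (n : nat) :
    {sigma_finite_measure set 'rV[R]_n -> \bar R} :=
  match n with
  | 0 => \d_(0 : 'rV[R]_0)
  | n'.+1 => lebesgue_rV_step (lebesgue_rV R n')
  end.

Section euclidean.
Context (R : realType) (n : nat).
Implicit Types (x y v : 'rV[R]_n) (G A : set 'rV[R]_n).

Definition dotv v x : R := \sum_i v 0 i * x 0 i.

(* The norm of ['rV[R]_n] in the library is the sup norm. *)
Definition eball x (r : R) : set 'rV[R]_n :=
  [set y | dotv (y - x) (y - x) < r ^+ 2].

(* Polyhedra are taken open, being the domains of function spaces. *)
Definition bounded_convex_polyhedron G : Prop :=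
  [/\ exists k (a : 'I_k -> 'rV[R]_n) (b : 'I_k -> R),
        G = [set x | forall i, dotv (a i) x < b i],
      bounded_set G & G !=set0].

Definition dilate (r : R) G : set 'rV[R]_n := [set r *: x | x in G].

Definition frontier G : set 'rV[R]_n := closure G `\` interior G.

(* For convex [G] these are the unit vectors of the normal cone at [x]; there is
   exactly one at every frontier point outside the faces of codimension >= 2. *)
Definition outer_unit_normal G x v : Prop :=
  dotv v v = 1 /\ forall y, G y -> dotv v (y - x) <= 0.

(* Null sets of the (n-1)-dimensional Hausdorff measure.  Since finite covers
   are allowed, only the empty set is null when n = 1. *)
Definition hausdorff_codim1_null A : Prop :=
  forall e : R, 0 < e ->
    exists (D : set nat) (c : nat -> 'rV[R]_n) (r : nat -> R),
      [/\ forall k, 0 < r k,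
          A `<=` \bigcup_(k in D) eball (c k) (r k) &
          (\esum_(k in D) (r k ^+ n.-1)%:E < e%:E)%E].

End euclidean.

Section sobolev.
Context (R : realType) (n : nat).
Implicit Types (G : set 'rV[R]_n) (f g phi : 'rV[R]_n -> R).

Definition square_integrable G f : Prop :=
  measurable_fun G f /\
  (lebesgue_rV R n).-integrable G (EFin \o (fun x => f x ^+ 2)).

Definition partial (i : 'I_n) f : 'rV[R]_n -> R :=
  fun x => 'D_(delta_mx 0 i) f x.

Definition partials (s : seq 'I_n) f : 'rV[R]_n -> R := foldr partial f s.

Definition smooth f : Prop :=
  forall s : seq 'I_n, continuous (partials s f) /\
    forall x i, derivable (partials s f) x (delta_mx 0 i).

Definition test_function G phi : Prop :=
  [/\ smooth phi, compact (closure [set x | phi x != 0]) &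
      closure [set x | phi x != 0] `<=` G].

Definition weak_partial G (i : 'I_n) f g : Prop :=
  forall phi, test_function G phi ->
    \int[lebesgue_rV R n]_(x in G) (f x * partial i phi x) =
    - \int[lebesgue_rV R n]_(x in G) (g x * phi x).

(* An element carries representatives of its weak derivatives; these are
   unique up to null sets. *)
Record sobolev22 G := Sobolev22 {
  sob_fun :> 'rV[R]_n -> R ;
  sob_grad : 'I_n -> 'rV[R]_n -> R ;
  sob_hess : 'I_n -> 'I_n -> 'rV[R]_n -> R ;
  sob_fun_L2 : square_integrable G sob_fun ;
  sob_grad_L2 : forall i, square_integrable G (sob_grad i) ;
  sob_hess_L2 : forall i j, square_integrable G (sob_hess i j) ;
  sob_gradP : forall i, weak_partial G i sob_fun (sob_grad i) ;
  sob_hessP : forall i j, weak_partial G j (sob_grad i) (sob_hess i j)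
}.

Definition laplacian G (u : sobolev22 G) : 'rV[R]_n -> R :=
  fun x => \sum_i sob_hess u i i x.

Definition normal_derivative G (u : sobolev22 G) (v : 'rV[R]_n) :
    'rV[R]_n -> R :=
  fun x => \sum_i v 0 i * sob_grad u i x.

(* The trace on the frontier of a W_2^1 function is its Lebesgue value taken
   from inside the domain, defined almost everywhere for the
   (n-1)-dimensional Hausdorff measure. *)
Definition has_trace G f (x : 'rV[R]_n) (l : R) : Prop :=
  (\int[lebesgue_rV R n]_(y in G `&` eball x r) `|f y - l|
     / fine (lebesgue_rV R n (G `&` eball x r))) @[r --> 0^'+] --> (0 : R).

Definition neumann G (u : sobolev22 G) : Prop :=
  exists2 N : set 'rV[R]_n, hausdorff_codim1_null N &
    forall x v, frontier G x -> ~ N x -> outer_unit_normal G x v ->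
      has_trace G (normal_derivative u v) x 0.

Definition nonzero G (u : sobolev22 G) : Prop :=
  ~ ae_eq (lebesgue_rV R n) G u (cst 0).

End sobolev.

Section functionals.
Context (R : realType) (n : nat) (alpha beta : R).
Implicit Types G Omega : set 'rV[R]_n.

Definition intpow (m : nat) G (u : sobolev22 G) : R :=
  \int[lebesgue_rV R n]_(x in G) (u x ^+ m).

Definition Qf G (u : sobolev22 G) : R :=
  \int[lebesgue_rV R n]_(x in G)
    ((laplacian u x + u x) ^+ 2 - alpha * u x ^+ 2).

Definition Ef G (u : sobolev22 G) : R :=
  2^-1 * Qf u - beta / 3 * intpow 3 u + 4^-1 * intpow 4 u.

Definition Lf G (u : sobolev22 G) : R :=
  Qf u - beta * intpow 3 u + intpow 4 u.

Definition Hf G (u : sobolev22 G) : R :=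
  2 * Qf u - 3 * beta * intpow 3 u + 4 * intpow 4 u.

Definition Sinf (m : nat) G : R :=
  inf [set Num.sqrt (Qf u) * `|intpow m u| `^ (- m%:R^-1) |
       u in [set u : sobolev22 G | neumann u /\ intpow m u != 0]].

(* For n <= 7 and alpha < 0, [Sinf 4 G] is positive by the Sobolev embedding
   of W_2^2 into L^4. *)
Definition beta0 G : R :=
  2 * Num.max (Num.sqrt (1 - alpha)) (Sinf 3 G ^+ 3 * Sinf 4 G ^- 2).

Definition beta_star Omega : \bar R :=
  ereal_sup [set (beta0 (dilate r Omega))%:E | r in [set r : R | 1 <= r]].

Definition ridge_nehari_set G : set (sobolev22 G) :=
  [set v | [/\ neumann v, nonzero v, Lf v = 0 & Hf v <= 0]].

Definition ridge_nehari_solution G (u : sobolev22 G) : Prop :=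
  ridge_nehari_set u /\
  forall v : sobolev22 G, ridge_nehari_set v -> Ef u <= Ef v.

End functionals.

(* Main.v *)
Require Import Defs.
From mathcomp Require Import all_boot all_order all_algebra.
From mathcomp Require Import all_classical all_reals all_analysis.
From mathcomp Require Import measurable_realfun ring lra.
Import Order.TTheory GRing.Theory Num.Theory.
Import numFieldNormedType.Exports.
Local Open Scope classical_set_scope.
Local Open Scope ring_scope.

Set Implicit Arguments.
Unset Strict Implicit.
Unset Printing Implicit Defensive.

(** The energy of a ridge-Nehari solution is at most that of any competitor on
    the ridge-Nehari set of the same domain, so one competitor of bounded energy
    in each dilated domain is enough.

    On the set, L = 0 turns the energy into beta I3 / 6 - I4 / 4, where I3 and
    I4 are the integrals of the cube and of the fourth power, and H <= 0 says
    2 I4 <= beta I3; hence the energy is nonnegative [Ef_ridge_ge0].  Along the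
    ray t u, L[t u] = 0 is the quadratic equation Q - beta I3 t + I4 t^2 = 0, and
    H[t u] <= 0 selects its smaller root.  A root exists as soon as
    4 Q I4 <= beta^2 I3^2, it satisfies beta I3 t <= 2 Q, and the energy there is
    at most (4/3) Q^3 / (beta I3)^2 [ray_meets_ridge].

    The hypothesis on beta enters through beta > 2 sqrt (1 - alpha)
    [sqrt_lt_of_beta_star].  For u = 1 all of Q / (1 - alpha), I3 and I4 equal the
    volume, so the discriminant condition holds with room to spare, but the energy
    grows like the volume.  Hence constants serve for bounded r only
    [constant_on_ridge].  For large r one takes a plateau function: 1 on a cube
    of half-side rho, 0 outside the cube of half-side rho + 1, with second
    derivatives bounded independently of rho.  Its Q, I3, I4 differ from those of
    the constant 1 on the inner cube by multiples of the volume of the shell,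
    which is negligible for large rho; so a fixed rho makes the discriminant
    condition true [plateau_ratio].  Once r is large the dilated domain contains
    a cube of half-side rho + 1, and since Q, I3 and I4 are controlled by volumes
    of cubes, the bound does not depend on where that cube sits [bump_on_ridge].

    To be a competitor, the plateau function must have weak derivatives in the
    sense of the iterated Lebesgue measure and zero normal trace.  The trace is
    trivial since the gradient vanishes near the frontier.  The weak derivatives
    are the classical ones by integration by parts, that is, because a partial
    derivative with bounded support has integral zero: its integral over every
    line in that direction vanishes, and Fubini's theorem along the iterated
    construction of the measure concludes [integral_lines_eq0]. *)

(** * Borel sets of row vectors, and the volume of cubes *)

Section borel.
Context (R : realType) (n : nat).
Implicit Types (x c : 'rV[R]_n) (r s : R).

Lemma rV_ballP x e y : 0 < e ->
  ball x e y <-> forall i, `|x 0 i - y 0 i| < e.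
Proof.
move=> e0; split=> [[_ xy] i|xy]; first exact: xy.
by split=> // i j; rewrite ord1; exact: xy.
Qed.

Lemma measurable_rV_forall (P : 'I_n -> set R) :
  (forall i, measurable (P i)) -> measurable [set x : 'rV[R]_n | forall i, P i (x 0 i)].
Proof.
move=> mP; rewrite (_ : [set _ | _] = \bigcap_i (rV_coor i @^-1` P i)); last first.
  by apply/seteqP; split=> x /= Px i; [move=> _; exact: Px|exact: (Px i)].
apply: fin_bigcap_measurable => // i _.
rewrite -[X in measurable X]setTI.
by apply: (@measurable_rV_coor R n i) => //; exact: mP.
Qed.

(** The sigma-algebra is generated by the coordinates; an open set belongs to it
    because it is the union of the countably many cubes with rational center
    and radius 1 / (k + 1) that it contains. *)
Lemma open_measurable_rV (O : set 'rV[R]_n) : open O -> measurable O.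
Proof.
move=> oO.
pose B (q : 'rV[rat]_n * nat) : set 'rV[R]_n :=
  [set y | forall i, ball (ratr (q.1 0 i) : R) q.2.+1%:R^-1 (y 0 i)].
have -> : O = \bigcup_(q in [set q | B q `<=` O]) B q.
  apply/seteqP; split=> [x Ox|x [q qO Bqx]]; last exact: qO.
  have /nbhs_ballP[e /= e0 eO] := open_nbhs_nbhs (conj oO Ox).
  have [k ke] : exists k : nat, k.+1%:R^-1 < e / 2.
    have [k _ kle] := near_infty_natSinv_lt (PosNum (divr_gt0 e0 (ltr0n R 2))).
    by exists k; apply: (kle k) => /=.
  have k0 : 0 < k.+1%:R^-1 :> R by [].
  have qex i : exists q : rat, ball (x 0 i) k.+1%:R^-1 (ratr q : R).
    have /(_ _)[] := @dense_rat R (ball (x 0 i) k.+1%:R^-1).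
    - by exists (x 0 i); exact: ballxx.
    - exact: ball_open.
    - by move=> y [xy [q _ qy]]; exists q; rewrite qy.
  have [q qP] := choice qex.
  exists (\row_i q i, k) => /=; last by move=> i; rewrite mxE; exact/ball_sym/qP.
  move=> y Bqy; apply: eO; apply/rV_ballP => // i.
  have := Bqy i; have := qP i; rewrite /= mxE -!ball_normE /=.
  move: ke; set w := _^-1 => ke; set p : R := ratr _.
  by rewrite !ltr_norml => /andP[? ?] /andP[? ?]; apply/andP; split; lra.
rewrite bigcup_mkcond; apply: countable_bigcupT_measurable => [|q]; first exact: countableP.
case: ifP => // _.
apply: (measurable_rV_forall (P := fun i => ball (ratr (q.1 0 i) : R) q.2.+1%:R^-1)) => i.
exact: measurable_ball.
Qed.

Lemma continuous_measurable_rV (f : 'rV[R]_n -> R) :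
  continuous f -> measurable_fun setT f.
Proof.
move=> /continuousP cf; apply: (measurability _ (RGenOpens.measurableE R)).
move=> _ [_ [a [b ->] <-]]; rewrite setTI; apply: open_measurable_rV.
exact/cf/interval_open.
Qed.

End borel.

Section cube.
Context (R : realType).

Definition cube n (c : 'rV[R]_n) (s : R) : set 'rV[R]_n :=
  [set x | forall i, `|x 0 i - c 0 i| <= s].

Lemma measurable_cube n (c : 'rV[R]_n) (s : R) : measurable (cube c s).
Proof.
apply: (measurable_rV_forall (P := fun i => [set t | `|t - c 0 i| <= s])) => i.
rewrite (_ : [set _ | _] = `[c 0 i - s, c 0 i + s]%classic) //.
by apply/seteqP; split=> t /=; rewrite in_itv /= ler_distl.
Qed.

Lemma lebesgue_cube n (c : 'rV[R]_n) (s : R) : 0 <= s ->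
  lebesgue_rV R n (cube c s) = ((2 * s) ^+ n)%:E.
Proof.
move=> s0; elim: n c => [|n IH] c.
  by rewrite /= diracE mem_set //; case.
rewrite /= /lebesgue_rV_step /pushforward.
have -> : @rV_cons R n @^-1` cube c s =
    `[c 0 ord0 - s, c 0 ord0 + s]%classic `*` cube (\row_i c 0 (lift ord0 i)) s.
  apply/seteqP; split=> [[a y] /= cs|[a y] /= [+ ys] i].
    split; first by have := cs ord0; rewrite mxE unlift_none in_itv /= ler_distl.
    by move=> i; have := cs (lift ord0 i); rewrite !mxE liftK.
  rewrite in_itv /= -ler_distl => acs; rewrite mxE.
  by case: unliftP => [j ->|->] //=; have := ys j; rewrite mxE.
rewrite product_measure1E //; last exact: measurable_cube.
rewrite [X in (_ * X)%E]IH exprS EFinM; congr (_ * _)%E.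
have /= -> := @lebesgue_measure_itv R `[c 0 ord0 - s, c 0 ord0 + s].
rewrite lte_fin; case: ifPn => [_|]; first by rewrite -EFinB; congr (_%:E); ring.
by rewrite -leNgt => ?; congr (_%:E); lra.
Qed.

End cube.

(** * Integrals that vanish line by line *)

Section lines.
Context (R : realType).
Local Notation mu := (@lebesgue_measure R).

(** Fubini's theorem requires integrability on the whole space; this supplies it
    for every integrand below. *)
Lemma bounded_support_integrable d (T : measurableType d)
    (m : {measure set T -> \bar R}) (A : set T) (g : T -> R) (M : R) :
  measurable A -> (m A < +oo)%E -> measurable_fun setT g ->
  (forall x, `|g x| <= M) -> (forall x, ~ A x -> g x = 0) ->
  m.-integrable setT (EFin \o g).
Proof.
move=> mA Afin mg gM gA.
have -> : EFin \o g = (EFin \o g) \_ A.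
  apply/funext => x; rewrite patchE; case: ifPn => // /negP Ax /=.
  by rewrite gA // => Ax'; apply: Ax; rewrite inE.
apply/integrable_restrict => //; rewrite setTI.
apply: measurable_bounded_integrable => //; first exact: measurable_funTS.
exists M; split; first exact: num_real.
by move=> y My x _; exact: le_trans (gM x) (ltW My).
Qed.

(** Induction on the dimension, peeling off coordinate 0 as the measure does: if
    the lines are parallel to that axis, the inner integral over it vanishes;
    otherwise the inner integral over the remaining coordinates vanishes by the
    induction hypothesis.  Pointwise bounds, unlike integrability, pass to every
    slice and so survive the induction. *)
Lemma integral_lines_eq0 n (i : 'I_n) (g : 'rV[R]_n -> R) (M s : R) : 0 <= s ->
  measurable_fun setT g -> (forall x, `|g x| <= M) ->
  (forall x, ~ cube 0 s x -> g x = 0) ->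
  (forall x, \int[mu]_t (g (x + t *: delta_mx 0 i))%:E = 0)%E ->
  (\int[lebesgue_rV R n]_x (g x)%:E = 0)%E.
Proof.
move=> s0; elim: n => [|n IH] in i g *; first by case: i.
move=> mg gM gs gi.
have mgc : measurable_fun setT (g \o @rV_cons R n).
  by apply: measurableT_comp => //; exact: measurable_rV_cons.
have igc : (mu \x lebesgue_rV R n)%E.-integrable setT (EFin \o (g \o @rV_cons R n)).
  apply: (@bounded_support_integrable _ _ _ (@rV_cons R n @^-1` cube 0 s) _ M) => //.
  - rewrite -[X in measurable X]setTI; apply: measurable_rV_cons => //.
    exact: measurable_cube.
  - have := @lebesgue_cube R n.+1 0 s s0.
    by rewrite /= /lebesgue_rV_step /pushforward => ->; rewrite ltry.
  - by move=> x; exact: gM.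
  - by move=> x; exact: gs.
rewrite /= /lebesgue_rV_step integral_pushforward //=; [|exact: measurable_rV_cons|exact/measurable_EFinP].
rewrite preimage_setT.
case: (unliftP ord0 i) => [j ij|i0].
- rewrite -(integral12_prod_meas1 igc).
  apply: integral0_eq => t _; rewrite /fubini_F.
  have gt : measurable_fun setT (fun y => g (rV_cons (t, y))).
    by apply: (measurableT_comp mgc); exact: measurable_pair1.
  apply: (IH j (fun y => g (rV_cons (t, y)))) => //.
    move=> y ys; apply: gs => tys; apply: ys => k.
    by have := tys (lift ord0 k); rewrite !mxE liftK.
  move=> y; rewrite -[RHS](gi (rV_cons (t, y))).
  apply: eq_integral => r _; congr (g _)%:E.
  apply/rowP => k; rewrite !mxE /=; case: (unliftP ord0 k) => [l ->|->] /=.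
    by rewrite !mxE ij /= (inj_eq lift_inj).
  by rewrite ij /= mulr0 addr0.
- rewrite -(integral21_prod_meas1 igc).
  apply: integral0_eq => y _; rewrite /fubini_G.
  rewrite -[RHS](gi (rV_cons (0, y))).
  apply: eq_integral => r _; congr (g _)%:E.
  apply/rowP => k; rewrite !mxE /=; case: (unliftP ord0 k) => [l ->|->] /=.
    by rewrite i0 /= mulr0 addr0.
  by rewrite i0 /= mulr1 add0r.
Qed.

End lines.

(** * Classical derivatives are weak derivatives *)

Section weak_derivatives.
Context (R : realType).
Local Notation mu := (@lebesgue_measure R).

Lemma integral_derivative_eq0 (F f : R -> R) (s : R) : 0 <= s ->
  continuous f -> (forall t : R, is_derive t 1 F (f t)) ->
  (forall t, s < `|t| -> F t = 0) -> (forall t, s < `|t| -> f t = 0) ->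
  (\int[mu]_t (f t)%:E = 0)%E.
Proof.
move=> s0 cf dF F0 f0.
pose a : R := s + 1; have a0 : 0 < a by rewrite ltr_wpDl.
have sa : s < `|a| by rewrite gtr0_norm // ltrDl.
have cF : continuous F.
  move=> t; apply/differentiable_continuous/derivable1_diffP.
  exact: (@ex_derive _ _ _ _ _ _ _ (dF t)).
pose I : set R := `[- a, a]%classic.
transitivity (\int[mu]_(t in I) (f t)%:E)%E.
  rewrite [RHS]integral_mkcond; apply: eq_integral => t _.
  rewrite patchE; case: ifPn => // /negP ta; rewrite f0 // ltNge.
  apply/negP => ts; apply: ta; rewrite inE /I /= in_itv /= -ler_norml.
  by rewrite (le_trans ts) // lerDl.
rewrite (@continuous_FTC2 R f F).
- by rewrite !F0 ?normrN // subee.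
- by rewrite gtrN.
- exact: continuous_subspaceT.
- split.
  + by move=> t _; exact: (@ex_derive _ _ _ _ _ _ _ (dF t)).
  + by apply: cvg_at_right_filter; exact: cF.
  + by apply: cvg_at_left_filter; exact: cF.
- by move=> t _; rewrite derive1E; exact: (@derive_val _ _ _ _ _ _ _ (dF t)).
Qed.

Lemma is_derive_line n (F : 'rV[R]_n -> R) (x v : 'rV[R]_n) (t df : R) :
  is_derive t 1 (fun r => F (x + r *: v)) df <-> is_derive (x + t *: v) v F df.
Proof.
have E : (fun h => h^-1 *: (((fun r : R => F (x + r *: v)) \o shift t) (h *: 1) - F (x + t *: v)))
   = (fun h : R => h^-1 *: ((F \o shift (x + t *: v)) (h *: v) - F (x + t *: v))).
  apply/funext => h /=; congr (_ *: (F _ - _)).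
  by rewrite [_%:A]mulr1 scalerDl addrCA.
by split=> -[dF <-]; split; move: dF; rewrite /derivable /derive E.
Qed.

Lemma integral_partial_eq0 n (i : 'I_n) (F f : 'rV[R]_n -> R) (M s : R) :
  0 <= s -> continuous f -> (forall x, is_derive x 'e_i F (f x)) ->
  (forall x, `|f x| <= M) ->
  (forall x, ~ cube 0 s x -> F x = 0) -> (forall x, ~ cube 0 s x -> f x = 0) ->
  (\int[lebesgue_rV R n]_x (f x)%:E = 0)%E.
Proof.
move=> s0 cf dF fM F0 f0.
apply: (integral_lines_eq0 (i := i) s0 _ fM f0) => [|x].
  exact: continuous_measurable_rV.
have out t : s + `|x 0 i| < `|t| -> ~ cube 0 s (x + t *: 'e_i).
  move=> st /(_ i); rewrite !mxE !eqxx /= mulr1 subr0 => xts.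
  have := ler_normB (x 0 i + t) (x 0 i); rewrite addrC addKr => tx.
  by move: st; rewrite ltNge => /negP; apply; rewrite (le_trans tx) // lerD2r.
apply: (@integral_derivative_eq0 (fun t => F (x + t *: 'e_i)) _ (s + `|x 0 i|)).
- by rewrite addr_ge0.
- move=> t; apply: (@continuous_comp _ _ _ (fun t : R => x + t *: 'e_i) f).
    by apply: cvgD; [exact: cvg_cst|exact: scalel_continuous].
  exact: cf.
- by move=> t; apply/is_derive_line; exact: dF.
- by move=> t /out; exact: F0.
- by move=> t /out; exact: f0.
Qed.

Lemma bounded_sub_cube n (K : set 'rV[R]_n) : bounded_set K ->
  exists2 s : R, 0 <= s & K `<=` cube 0 s.
Proof.
move=> [M [_ MK]]; exists (`|M| + 1); first by rewrite addr_ge0.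
move=> x Kx i; rewrite mxE subr0.
apply: le_trans (MK (`|M| + 1) _ x Kx); last by rewrite (le_lt_trans (ler_norm M)) ?ltrDl.
rewrite [leRHS]mx_normrE.
exact: (le_bigmax_cond _ (fun ij => `|x ij.1 ij.2|) (isT : xpredT (ord0, i))).
Qed.

Lemma compact_support_bounded n (K : set 'rV[R]_n) (f : 'rV[R]_n -> R) :
  compact K -> continuous f -> (forall x, ~ K x -> f x = 0) ->
  exists M : R, forall x, `|f x| <= M.
Proof.
move=> cK cf fK.
have /compact_bounded[M [_ MK]] : compact (f @` K).
  by apply: continuous_compact => //; exact: continuous_subspaceT.
exists (`|M| + 1) => x; have [Kx|nKx] := pselect (K x).
  apply: MK; last by exists x.
  by rewrite (le_lt_trans (ler_norm M)) ?ltrDl.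
by rewrite fK // normr0 addr_ge0.
Qed.

(** The derivative of f phi in direction i is f times the derivative of phi plus
    g phi; it is continuous with compact support, so its integral is zero.  All
    integrals over G extend to the whole space since phi is supported in G. *)
Lemma weak_partial_classical n (G : set 'rV[R]_n) (i : 'I_n)
    (f g : 'rV[R]_n -> R) (M : R) :
  continuous f -> continuous g -> (forall x, is_derive x 'e_i f (g x)) ->
  (forall x, `|f x| <= M) -> (forall x, `|g x| <= M) ->
  weak_partial G i f g.
Proof.
move=> cf cg df fM gM phi [sphi cK KG].
pose K := closure [set x | phi x != 0].
have phiK x : ~ K x -> phi x = 0.
  by move=> Kx; apply/eqP/negP => /negP p; apply: Kx; exact: subset_closure.
have cphi : continuous phi := (sphi [::]).1.
have dphi x : is_derive x 'e_i phi (partial i phi x).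
  by apply: derivableP; exact: (sphi [::]).2.
have cp : continuous (partial i phi) := (sphi [:: i]).1.
have pK x : ~ K x -> partial i phi x = 0.
  move=> Kx; rewrite /partial.
  have -> : 'D_'e_i phi x = 'D_'e_i (cst 0) x.
    apply: near_eq_derive.
    have oK : open (~` K) by apply: closed_openC; exact: closed_closure.
    have : nbhs x (~` K) by apply: open_nbhs_nbhs.
    by apply: filterS => y /phiK.
  by have [_] := is_derive_cst (0 : R) x 'e_i.
have [s s0 Ks] := bounded_sub_cube (compact_bounded cK).
have [A phiA] := compact_support_bounded cK cphi phiK.
have [B pB] := compact_support_bounded cK cp pK.
have off h : (forall x, ~ K x -> h x = 0) -> forall x, ~ cube 0 s x -> h x = 0.
  by move=> hK x xs; apply: hK => Kx; apply: xs; exact: Ks.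
have restr (h : 'rV[R]_n -> R) : (forall x, ~ K x -> h x = 0) ->
    \int[lebesgue_rV R n]_(x in G) h x = \int[lebesgue_rV R n]_x h x.
  move=> hK; rewrite Rintegral_mkcond; congr (Rintegral _ _ _).
  apply/funext => x; rewrite patchE; case: ifPn => // /negP Gx.
  by rewrite hK // => Kx; apply: Gx; rewrite inE; exact: KG.
have integ (h k : 'rV[R]_n -> R) C : continuous h -> continuous k ->
    (forall x, `|h x| <= M) -> (forall x, `|k x| <= C) ->
    (forall x, ~ K x -> k x = 0) ->
    (lebesgue_rV R n).-integrable setT (EFin \o (fun x => h x * k x)).
  move=> ch ck hM kC kK.
  apply: (@bounded_support_integrable _ _ _ _ (cube 0 s) _ (M * C)).
  - exact: measurable_cube.
  - by have := lebesgue_cube (0 : 'rV[R]_n) s0; move=> /= ->; rewrite ltry.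
  - by apply: measurable_funM; exact: continuous_measurable_rV.
  - by move=> x; rewrite normrM ler_pM.
  - by apply: off => x /kK ->; rewrite mulr0.
rewrite !restr; last 2 first.
- by move=> x /phiK ->; rewrite mulr0.
- by move=> x /pK ->; rewrite mulr0.
apply/eqP; rewrite -subr_eq0 opprK -RintegralD //.
- suff I0 : (\int[lebesgue_rV R n]_x (f x * partial i phi x + g x * phi x)%:E = 0)%E.
    by rewrite /Rintegral I0.
  apply: (@integral_partial_eq0 _ i (f * phi) _ (M * B + M * A) s) => //.
  + rewrite -[X in continuous X]/(f * partial i phi + g * phi) => x.
    apply: continuousD; apply: continuousM; [exact: cf|exact: cp|exact: cg|exact: cphi].
  + move=> x; have := is_deriveM (df x) (dphi x).
    by congr is_derive; rewrite [phi x *: _]mulrC.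
  + move=> x; rewrite (le_trans (ler_normD _ _)) // !normrM lerD // ler_pM //.
  + by apply: off => x /phiK p0; rewrite -[LHS]/(f x * phi x) p0 mulr0.
  + by apply: off => x /[dup] /phiK -> /pK ->; rewrite !mulr0 addr0.
- exact: integ pB pK.
- exact: integ phiA phiK.
Qed.

End weak_derivatives.

(** * Bounded functions of class C2 as Sobolev elements *)

Section continuity.
Context (R : realType) (T : topologicalType).
Implicit Types f k : T -> R.

Lemma continuous_funD f k : continuous f -> continuous k ->
  continuous (fun x => f x + k x).
Proof.
move=> cf ck; rewrite -[X in continuous X]/(f + k) => x.
by apply: continuousD; [exact: cf|exact: ck].
Qed.

Lemma continuous_funN f : continuous f -> continuous (fun x => - f x).
Proof. by move=> cf x; apply: cvgN; exact: cf. Qed.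

Lemma continuous_funM f k : continuous f -> continuous k ->
  continuous (fun x => f x * k x).
Proof.
move=> cf ck; rewrite -[X in continuous X]/(f * k) => x.
by apply: continuousM; [exact: cf|exact: ck].
Qed.

Lemma continuous_fun_sum m (f_ : 'I_m -> T -> R) :
  (forall i, continuous (f_ i)) -> continuous (fun x => \sum_i f_ i x).
Proof.
move=> cf; elim: m f_ cf => [|m IH] f_ cf.
  by under eq_fun do rewrite big_ord0; exact: cst_continuous.
under eq_fun do rewrite big_ord_recl.
by apply: continuous_funD => //; exact: IH.
Qed.

End continuity.

Section classical_elements.
Context (R : realType) (n : nat).
Implicit Types (G : set 'rV[R]_n) (f k : 'rV[R]_n -> R).

Definition bounded_continuous f :=
  continuous f /\ exists M : R, forall x, `|f x| <= M.

Lemma bounded_continuous_cst (a : R) : bounded_continuous (fun=> a).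
Proof.
split; first by move=> x; apply: (@cst_continuous _ R a).
by exists `|a|.
Qed.

Lemma bounded_continuousD f k : bounded_continuous f -> bounded_continuous k ->
  bounded_continuous (fun x => f x + k x).
Proof.
move=> [cf [M fM]] [ck [N kN]]; split.
  exact: continuous_funD.
by exists (M + N) => x; apply: le_trans (ler_normD _ _) _; exact: lerD.
Qed.

Lemma bounded_continuousM f k : bounded_continuous f -> bounded_continuous k ->
  bounded_continuous (fun x => f x * k x).
Proof.
move=> [cf [M fM]] [ck [N kN]]; split.
  exact: continuous_funM.
by exists (M * N) => x; rewrite normrM ler_pM.
Qed.

Lemma bounded_continuousX f m : bounded_continuous f ->
  bounded_continuous (fun x => f x ^+ m).
Proof.
move=> bf; elim: m => [|m IH].
  by under eq_fun do rewrite expr0; exact: bounded_continuous_cst.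
by under eq_fun do rewrite exprS; exact: bounded_continuousM.
Qed.

Lemma bounded_continuous_sum m (f_ : 'I_m -> 'rV[R]_n -> R) :
  (forall i, bounded_continuous (f_ i)) ->
  bounded_continuous (fun x => \sum_i f_ i x).
Proof.
move=> bf; elim: m f_ bf => [|m IH] f_ bf.
  by under eq_fun do rewrite big_ord0; exact: bounded_continuous_cst.
under eq_fun do rewrite big_ord_recl.
by apply: bounded_continuousD => //; exact: IH.
Qed.

Lemma bounded_continuous_integrable G f :
  measurable G -> (lebesgue_rV R n G < +oo)%E -> bounded_continuous f ->
  (lebesgue_rV R n).-integrable G (EFin \o f).
Proof.
move=> mG Goo [cf [M fM]]; apply: measurable_bounded_integrable => //.
  by apply: measurable_funTS; exact: continuous_measurable_rV.
exists M; split; first exact: num_real.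
by move=> y My x _; exact: le_trans (fM x) (ltW My).
Qed.

(** The derivatives are explicit data, so that they become definitionally the weak
    derivatives of the Sobolev element built from them. *)
Record bounded_C2 f (g : 'I_n -> 'rV[R]_n -> R)
    (h : 'I_n -> 'I_n -> 'rV[R]_n -> R) : Prop := BoundedC2 {
  bC2_fun : bounded_continuous f ;
  bC2_grad : forall i, bounded_continuous (g i) ;
  bC2_hess : forall i j, bounded_continuous (h i j) ;
  bC2_gradP : forall i x, is_derive x 'e_i f (g i x) ;
  bC2_hessP : forall i j x, is_derive x 'e_j (g i) (h i j x) }.

Lemma bounded_C2_cst (a : R) :
  bounded_C2 (fun=> a) (fun _ _ => 0) (fun _ _ _ => 0).
Proof.
by split=> *; solve [exact: bounded_continuous_cst|exact: is_derive_cst].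
Qed.

Lemma bounded_C2Z (a : R) f g h : bounded_C2 f g h ->
  bounded_C2 (fun x => a * f x) (fun i x => a * g i x) (fun i j x => a * h i j x).
Proof.
have bZ k : bounded_continuous k -> bounded_continuous (fun x => a * k x).
  by move=> bk; apply: bounded_continuousM => //; exact: bounded_continuous_cst.
move=> [bf bg bh df dg]; split.
- exact: bZ.
- by move=> i; exact: bZ.
- by move=> i j; exact: bZ.
- by move=> i x; exact: (is_deriveZ a (df i x)).
- by move=> i j x; exact: (is_deriveZ a (dg i j x)).
Qed.

Lemma weak_partial_bounded G i f k :
  bounded_continuous f -> bounded_continuous k ->
  (forall x, is_derive x 'e_i f (k x)) -> weak_partial G i f k.
Proof.
move=> [cf [M fM]] [ck [N kN]] df.
apply: (@weak_partial_classical _ _ _ _ _ _ (Num.max M N)) => // x.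
  by rewrite le_max fM.
by rewrite le_max kN orbT.
Qed.

Section element.
Variables (G : set 'rV[R]_n) (mG : measurable G).
Hypothesis Goo : (lebesgue_rV R n G < +oo)%E.

Lemma square_integrable_bounded f : bounded_continuous f -> square_integrable G f.
Proof.
move=> bf; split; first by apply: measurable_funTS; exact: continuous_measurable_rV bf.1.
by apply: bounded_continuous_integrable => //; exact: bounded_continuousX.
Qed.

Definition sobolev_of_C2 f g h (C : bounded_C2 f g h) : sobolev22 G :=
  Sobolev22 (square_integrable_bounded (bC2_fun C))
    (fun i => square_integrable_bounded (bC2_grad C i))
    (fun i j => square_integrable_bounded (bC2_hess C i j))
    (fun i => weak_partial_bounded (G := G) (bC2_fun C) (bC2_grad C i) (bC2_gradP C i))
    (fun i j => weak_partial_bounded (G := G) (bC2_grad C i) (bC2_hess C i j) (bC2_hessP C i j)).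

End element.

Lemma hausdorff_codim1_null_set0 : hausdorff_codim1_null (set0 : set 'rV[R]_n).
Proof.
move=> e e0; exists set0, (fun=> 0), (fun=> 1); split => //.
by rewrite esum_set0 lte_fin.
Qed.

(** For small radii the averages that define the trace are zero, and the
    exceptional null set can be taken empty. *)
Lemma neumann_of_locally_flat G (u : sobolev22 G) :
  (forall x, frontier G x -> exists2 e : R, 0 < e &
     forall y, G y -> eball x e y -> forall i, sob_grad u i y = 0) ->
  neumann u.
Proof.
move=> flat; exists set0; first exact: hausdorff_codim1_null_set0.
move=> x v /flat[e e0 ue] _ _; rewrite /has_trace.
apply: cvg_near_cst; near=> r.
rewrite [X in X / _](_ : _ = 0) ?mul0r //.
rewrite (@eq_Rintegral _ _ _ _ _ (cst 0)).
  by rewrite /Rintegral integral0.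
move=> y; rewrite inE => -[Gy xry]; rewrite subr0 /normal_derivative big1 ?normr0 //.
move=> i _; rewrite (ue y) ?mulr0 //.
have r0 : 0 < r by near: r; exact: nbhs_right_gt.
have re : r < e by near: r; exact: nbhs_right_lt.
by apply: (lt_trans xry); rewrite ltr_pXn2r // nnegrE ltW.
Unshelve. all: by end_near. Qed.

(** A null function has null power integrals. *)
Lemma nonzero_of_intpow G (u : sobolev22 G) m : measurable G ->
  (0 < m)%N -> intpow m u != 0 -> nonzero u.
Proof.
move=> mG m0 /eqP um u0; apply: um.
have mu : measurable_fun G u := (sob_fun_L2 u).1.
rewrite /intpow /Rintegral (ae_eq_integral (cst 0)%E) //.
- by rewrite integral0.
- by apply/measurable_EFinP; exact: measurable_funX.
- move: u0; apply: filterS => x /= ux Gx.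
  by rewrite ux // expr0n eqn0Ngt m0.
Qed.

End classical_elements.

(** * Where a ray meets the ridge-Nehari set *)

Section ray.
Context (R : realType).

(** The smaller root t of i4 t^2 - b i3 t + q lies left of the vertex, which is the
    third claim; then i4 t^2 is at most half of b i3 t, and the equation gives the
    last one. *)
Lemma nehari_root (b q i3 i4 : R) : 0 < b -> 0 < q -> 0 < i3 -> 0 < i4 ->
  4 * q * i4 <= b ^+ 2 * i3 ^+ 2 ->
  exists t : R, [/\ 0 < t, q - b * i3 * t + i4 * t ^+ 2 = 0,
    2 * i4 * t <= b * i3 & b * i3 * t <= 2 * q].
Proof.
move=> b0 q0 i30 i40 disc.
pose B := b * i3; have B0 : 0 < B by exact: mulr_gt0.
pose D := B ^+ 2 - 4 * q * i4.
have D0 : 0 <= D by rewrite subr_ge0 exprMn.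
have sD : Num.sqrt D ^+ 2 = D by exact: sqr_sqrtr.
have sD0 := sqrtr_ge0 D.
have sDB : Num.sqrt D < B.
  rewrite -(@ltr_pXn2r _ 2) // ?nnegrE ?(ltW B0) // sD /D gtrBl.
  by rewrite !mulr_gt0.
have i4n : i4 != 0 by rewrite gt_eqF.
exists ((B - Num.sqrt D) / (2 * i4)); set t := _ / _.
have ti4 : 2 * i4 * t = B - Num.sqrt D by rewrite /t; field.
have t0 : 0 < t by rewrite divr_gt0 ?subr_gt0 // mulr_gt0.
have root : q - B * t + i4 * t ^+ 2 = 0.
  rewrite (_ : t ^+ 2 = (B ^+ 2 - 2 * B * Num.sqrt D + D) / (4 * i4 ^+ 2)).
    by rewrite /t /D; field.
  by rewrite -{2}sD /t; field.
have tB : 2 * i4 * t <= B by rewrite ti4; lra.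
split => //.
have : 2 * i4 * t * t <= B * t by rewrite ler_pM2r.
by move: root; rewrite -/B; nra.
Qed.

Context (n : nat) (alpha beta : R).

Lemma Ef_of_Lf_eq0 (G : set 'rV[R]_n) (u : sobolev22 G) : Lf alpha beta u = 0 ->
  Ef alpha beta u = beta / 6 * intpow 3 u - 4^-1 * intpow 4 u.
Proof. by rewrite /Lf /Ef; lra. Qed.

(** L = 0 and H <= 0 give 2 I4 <= beta I3, so the energy is at least I4 / 12. *)
Lemma Ef_ridge_ge0 (G : set 'rV[R]_n) (u : sobolev22 G) :
  ridge_nehari_set alpha beta u -> 0 <= Ef alpha beta u.
Proof.
move=> [_ _ Lu Hu]; rewrite Ef_of_Lf_eq0 //.
have I4 : 0 <= intpow 4 u.
  by apply: Rintegral_ge0 => x _; rewrite -[4%N]/(2 * 2)%N exprM sqr_ge0.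
by move: Lu Hu; rewrite /Lf /Hf; lra.
Qed.

(** [Qf] before a Sobolev element is built, so that it can be evaluated once and
    for all multiples of f. *)
Definition C2_Qf (G : set 'rV[R]_n) (f : 'rV[R]_n -> R)
    (h : 'I_n -> 'I_n -> 'rV[R]_n -> R) : R :=
  \int[lebesgue_rV R n]_(x in G) ((\sum_i h i i x + f x) ^+ 2 - alpha * f x ^+ 2).

(** L[t f] is t^2 times the quadratic of [nehari_root], and H[t f] equals
    t^3 (2 I4 t - beta I3) at its roots.  The energy is at most beta I3 t^3 / 6,
    which beta I3 t <= 2 q turns into the stated bound. *)
Lemma ray_meets_ridge (G : set 'rV[R]_n) (f : 'rV[R]_n -> R) g h :
  measurable G -> (lebesgue_rV R n G < +oo)%E -> bounded_C2 f g h ->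
  (forall x, frontier G x -> exists2 e : R, 0 < e &
     forall y, G y -> eball x e y -> forall i, g i y = 0) ->
  let q := C2_Qf G f h in
  let i3 := \int[lebesgue_rV R n]_(x in G) f x ^+ 3 in
  let i4 := \int[lebesgue_rV R n]_(x in G) f x ^+ 4 in
  0 < beta -> 0 < q -> 0 < i3 -> 0 < i4 ->
  4 * q * i4 <= beta ^+ 2 * i3 ^+ 2 ->
  exists2 v : sobolev22 G, ridge_nehari_set alpha beta v &
    Ef alpha beta v <= 4 / 3 * (q ^+ 3 / (beta ^+ 2 * i3 ^+ 2)).
Proof.
move=> mG Goo C flat q i3 i4 b0 q0 i30 i40 disc.
have [t [t0 root ti4 tq]] := nehari_root b0 q0 i30 i40 disc.
have Ct := bounded_C2Z t C.
pose v := sobolev_of_C2 mG Goo Ct.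
have bf := bC2_fun C.
have Im m : intpow m v = t ^+ m * \int[lebesgue_rV R n]_(x in G) f x ^+ m.
  rewrite /intpow /= -RintegralZl //.
    by apply: eq_Rintegral => x _; rewrite exprMn.
  by apply: bounded_continuous_integrable => //; exact: bounded_continuousX.
have Qv : Qf alpha v = t ^+ 2 * q.
  rewrite /q /C2_Qf -RintegralZl //.
    apply: eq_Rintegral => x _; rewrite /laplacian /= -mulr_sumr; ring.
  apply: bounded_continuous_integrable => //.
  apply: bounded_continuousD.
    apply: bounded_continuousX; apply: bounded_continuousD => //.
    by apply: bounded_continuous_sum => i; exact: (bC2_hess C).
  under eq_fun do rewrite -mulNr.
  apply: bounded_continuousM; first exact: bounded_continuous_cst.
  exact: bounded_continuousX.
have I3 := Im 3; have I4 := Im 4; rewrite -/i3 in I3; rewrite -/i4 in I4.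
have Lv : Lf alpha beta v = 0.
  rewrite /Lf Qv I3 I4; transitivity (t ^+ 2 * (q - beta * i3 * t + i4 * t ^+ 2)); first by ring.
  by rewrite root mulr0.
exists v.
  split => //.
  - apply: neumann_of_locally_flat => x /flat[e e0 ge]; exists e => // y Gy xy i.
    by rewrite /= (ge y) // mulr0.
  - apply: (@nonzero_of_intpow _ _ _ _ 3) => //.
    by rewrite I3 gt_eqF // mulr_gt0 // exprn_gt0.
  - rewrite /Hf Qv I3 I4.
    have -> : 2 * (t ^+ 2 * q) - 3 * beta * (t ^+ 3 * i3) + 4 * (t ^+ 4 * i4)
        = t ^+ 3 * (2 * i4 * t - beta * i3)
          + 2 * t ^+ 2 * (q - beta * i3 * t + i4 * t ^+ 2) by ring.
    rewrite root mulr0 addr0 mulr_ge0_le0 ?subr_le0 //.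
    by rewrite exprn_ge0 // ltW.
rewrite (Ef_of_Lf_eq0 Lv) I3 I4.
have t4 : 0 <= 4^-1 * (t ^+ 4 * i4) by rewrite !mulr_ge0 // ?exprn_ge0 // ltW.
have B0 : 0 < beta * i3 by exact: mulr_gt0.
have : (beta * i3 * t) ^+ 3 <= (2 * q) ^+ 3.
  by rewrite ler_pXn2r // nnegrE ltW // mulr_gt0.
rewrite -exprMn -(@ler_pM2r _ ((beta * i3) ^- 2 / 6)); last first.
  by rewrite divr_gt0 // invr_gt0 exprn_gt0.
have -> : (beta * i3 * t) ^+ 3 * ((beta * i3) ^- 2 / 6) = beta / 6 * (t ^+ 3 * i3).
  by field; rewrite !gt_eqF.
have -> : (2 * q) ^+ 3 * ((beta * i3) ^- 2 / 6) = 4 / 3 * (q ^+ 3 / (beta * i3) ^+ 2).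
  by field; rewrite !gt_eqF.
by lra.
Qed.

End ray.

(** * Powers of the positive part *)

Section bump_derivatives.
Context (R : realType).

Definition pos_part (t : R) : R := Num.max t 0.

Lemma pos_part_ge0 t : 0 <= pos_part t.
Proof. by rewrite le_max lexx orbT. Qed.

Lemma pos_part_eq0 t : t <= 0 -> pos_part t = 0.
Proof. exact: max_r. Qed.

Lemma pos_part_id t : 0 <= t -> pos_part t = t.
Proof. exact: max_l. Qed.

Lemma continuous_pos_partX k : continuous (fun t => pos_part t ^+ k).
Proof.
move=> t; apply: (@continuous_comp _ _ _ pos_part (fun s : R => s ^+ k)).
  by apply: continuous_max; [exact: cvg_id|exact: cvg_cst].
exact: exprn_continuous.
Qed.

(** At 0 the difference quotient of the power k + 2 is the power k + 1 of the
    increment, or 0, and both tend to 0. *)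
Lemma is_derive_pos_partX k (t : R) :
  is_derive t 1 (fun s => pos_part s ^+ k.+2) (k.+2%:R * pos_part t ^+ k.+1).
Proof.
case: (ltrgtP t 0) => [t0|t0|->].
- apply: (@near_eq_is_derive R R R (cst 0)).
    near=> s; rewrite /cst pos_part_eq0 ?expr0n //.
    by apply/ltW; near: s; exact: lt_nbhsl.
  by rewrite (pos_part_eq0 (ltW t0)) expr0n mulr0; exact: is_derive_cst.
- have dX : is_derive t (1 : R) ((id : R -> R) ^+ k.+2) (k.+2%:R * pos_part t ^+ k.+1).
    rewrite (pos_part_id (ltW t0)).
    by apply: is_derive_eq (is_deriveX _ (is_derive_id t 1)) _; rewrite [_ *: _]mulr1.
  apply: near_eq_is_derive dX.
  near=> s; rewrite exprfctE pos_part_id //.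
  by apply/ltW; near: s; exact: lt_nbhsr.
- have c0 : (fun h : R => h^-1 *: (((fun s => pos_part s ^+ k.+2) \o shift 0) (h *: 1)
       - pos_part 0 ^+ k.+2)) @ 0^' --> (0 : R).
    have c1 : (fun h => pos_part h ^+ k.+1) @ 0^' --> (0 : R).
      have := @continuous_pos_partX k.+1 0; rewrite /continuous_at pos_part_eq0 // expr0n.
      exact: cvg_within_filter.
    apply: cvg_trans c1; apply: near_eq_cvg; near=> h => /=.
    rewrite addr0 [_%:A]mulr1 (pos_part_eq0 (lexx _)) expr0n subr0.
    have h0 : h != 0 by near: h; exact: nbhs_dnbhs_neq.
    case: (lerP 0 h) => hs; last by rewrite pos_part_eq0 ?(ltW hs) // !expr0n scaler0.
    by rewrite pos_part_id // [in RHS]exprS [_ *: _]mulrA mulVf ?mul1r.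
  rewrite (pos_part_eq0 (lexx 0)) expr0n mulr0.
  by split; [apply/cvg_ex; exists 0|apply/cvg_lim].
Unshelve. all: by end_near. Qed.

(** Differentiating along v is differentiating a function of one variable, which
    reduces this chain rule to the one-dimensional one. *)
Lemma is_derive_chain n (F : 'rV[R]_n -> R) (p : R -> R) (x v : 'rV[R]_n) (a b : R) :
  is_derive x v F a -> is_derive (F x) 1 p b -> is_derive x v (fun y => p (F y)) (b * a).
Proof.
move=> dF dp; rewrite -[x]addr0 -(scale0r v); apply/is_derive_line.
apply: (@is_derive1_comp R p (fun r => F (x + r *: v)) 0 b a).
  by rewrite scale0r addr0.
by apply/is_derive_line; rewrite scale0r addr0.
Qed.

Lemma is_derive_coord n (i j : 'I_n) (x : 'rV[R]_n) :
  is_derive x 'e_j (fun y : 'rV[R]_n => y 0 i) (i == j)%:R.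
Proof.
have E : (fun h : R => h^-1 *: (((fun y : 'rV[R]_n => y 0 i) \o shift x) (h *: 'e_j) - x 0 i))
    @ 0^' --> ((i == j)%:R : R).
  apply: cvg_near_cst; near=> h; rewrite /= !mxE eqxx /= addrK.
  by rewrite [_ *: _]mulrA mulVf ?mul1r //; near: h; exact: nbhs_dnbhs_neq.
by split; [apply/cvg_ex; exists (i == j)%:R|apply/cvg_lim].
Unshelve. all: by end_near. Qed.

End bump_derivatives.

(** * The plateau function *)

Section bump.
Context (R : realType) (n : nat) (c : 'rV[R]_n) (rho : R).
Implicit Types (x : 'rV[R]_n) (s t : R).

(** [wall] is of class C2, zero for |s| <= rho and at least 1 for
    |s| >= rho + 1.  Hence 1 minus the sum of the walls of all coordinates is 1 on the
    inner cube and nonpositive outside the outer one, and the cube of its positive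
    part is a plateau of class C2. *)
Definition wall s : R := pos_part (s - rho) ^+ 3 + pos_part (- s - rho) ^+ 3.
Definition wall' s : R := 3 * pos_part (s - rho) ^+ 2 - 3 * pos_part (- s - rho) ^+ 2.
Definition wall'' s : R := 6 * pos_part (s - rho) ^+ 1 + 6 * pos_part (- s - rho) ^+ 1.

Let dl k s : is_derive s 1 (fun t => pos_part (t - rho) ^+ k.+2)
  (k.+2%:R * pos_part (s - rho) ^+ k.+1).
Proof.
have d : is_derive s (1 : R) (fun t => t - rho : R) (1 - 0).
  exact: is_deriveB (is_derive_id s 1) (is_derive_cst rho s 1).
have := @is_derive1_comp R _ (fun t => t - rho) s _ _ (is_derive_pos_partX k (s - rho)) d.
by rewrite subr0 mulr1.
Qed.

Let dr k s : is_derive s 1 (fun t => pos_part (- t - rho) ^+ k.+2)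
  (- (k.+2%:R * pos_part (- s - rho) ^+ k.+1)).
Proof.
have d : is_derive s (1 : R) (fun t => - t - rho : R) (- 1 - 0).
  exact: is_deriveB (is_deriveN (is_derive_id s 1)) (is_derive_cst rho s 1).
have := @is_derive1_comp R _ (fun t => - t - rho) s _ _ (is_derive_pos_partX k (- s - rho)) d.
by rewrite subr0 mulrN1.
Qed.

Lemma is_derive_wall s : is_derive s 1 wall (wall' s).
Proof. exact: is_deriveD (dl 1 s) (dr 1 s). Qed.

Lemma is_derive_wall' s : is_derive s 1 wall' (wall'' s).
Proof.
apply: is_derive_eq (is_deriveB (is_deriveZ 3 (dl 0 s)) (is_deriveZ 3 (dr 0 s))) _.
by rewrite /wall'' [_ *: _]mulrA [_ *: _]mulrN opprK mulrA -natrM.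
Qed.

Lemma wall_ge0 s : 0 <= wall s.
Proof. by rewrite addr_ge0 // exprn_ge0 // pos_part_ge0. Qed.

Lemma wall_flat s : `|s| <= rho -> [/\ wall s = 0, wall' s = 0 & wall'' s = 0].
Proof.
rewrite ler_norml => /andP[sl sr]; rewrite /wall /wall' /wall''.
have -> : pos_part (s - rho) = 0 by apply: pos_part_eq0; lra.
have -> : pos_part (- s - rho) = 0 by apply: pos_part_eq0; lra.
by rewrite !expr0n /= !mulr0 !addr0 subr0.
Qed.

Lemma wall_ge1 s : rho + 1 <= `|s| -> 1 <= wall s.
Proof.
have p1 t : 1 <= t -> 1 <= pos_part t ^+ 3.
  by move=> t1; rewrite exprn_ege1 // le_max t1.
rewrite /wall; have [s0|s0] := ger0P s => rs.
  by rewrite ler_wpDr ?exprn_ge0 ?pos_part_ge0 // p1 //; lra.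
by rewrite ler_wpDl ?exprn_ge0 ?pos_part_ge0 // p1 //; lra.
Qed.

(** Where the bump is nonzero every wall is below 1, so both positive parts are
    at most 1: this bounds the derivatives uniformly in rho. *)
Lemma wall_le1_bounds s : wall s <= 1 -> `|wall' s| <= 3 /\ `|wall'' s| <= 12.
Proof.
rewrite /wall /wall' /wall''; set p := pos_part (s - rho); set q := pos_part _.
have p0 : 0 <= p by exact: pos_part_ge0.
have q0 : 0 <= q by exact: pos_part_ge0.
move=> pq.
have le1 (t : R) : 0 <= t -> t ^+ 3 <= 1 -> t <= 1.
  by move=> t0; rewrite expr_le1.
have p1 : p <= 1 by apply: le1 => //; apply: le_trans pq; rewrite lerDl exprn_ge0.
have q1 : q <= 1 by apply: le1 => //; apply: le_trans pq; rewrite lerDr exprn_ge0.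
have p2 : 0 <= p ^+ 2 <= 1 by rewrite exprn_ge0 // exprn_ile1.
have q2 : 0 <= q ^+ 2 <= 1 by rewrite exprn_ge0 // exprn_ile1.
by rewrite !expr1 !ler_norml; split; lra.
Qed.

Definition depth x : R := 1 - \sum_i wall (x 0 i - c 0 i).

Definition bump x : R := pos_part (depth x) ^+ 3.

Definition bump_grad (i : 'I_n) x : R :=
  - (3 * pos_part (depth x) ^+ 2 * wall' (x 0 i - c 0 i)).

Definition bump_hess (i j : 'I_n) x : R :=
  6 * pos_part (depth x) ^+ 1 * wall' (x 0 i - c 0 i) * wall' (x 0 j - c 0 j)
  - (i == j)%:R * (3 * pos_part (depth x) ^+ 2 * wall'' (x 0 i - c 0 i)).

Let d_coord (p p' : R -> R) i j x : (forall s, is_derive s 1 p (p' s)) ->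
  is_derive x 'e_j (fun y : 'rV[R]_n => p (y 0 i - c 0 i)) ((i == j)%:R * p' (x 0 i - c 0 i)).
Proof.
move=> dp; rewrite mulrC.
apply: (is_derive_chain (F := fun y : 'rV[R]_n => y 0 i - c 0 i)) (dp _).
apply: is_derive_eq (is_deriveB (is_derive_coord i j x) (is_derive_cst (c 0 i) x 'e_j)) _.
by rewrite subr0.
Qed.

Lemma is_derive_depth j x : is_derive x 'e_j depth (- wall' (x 0 j - c 0 j)).
Proof.
have dS : is_derive x 'e_j (fun y : 'rV[R]_n => \sum_i wall (y 0 i - c 0 i))
    (\sum_(i < n) (i == j)%:R * wall' (x 0 i - c 0 i)).
  have := is_derive_sum (fun i => d_coord i j x is_derive_wall).
  by congr is_derive; apply/funext => y; rewrite fct_sumE.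
have := is_deriveB (is_derive_cst (1 : R) x 'e_j) dS.
rewrite sub0r (bigD1 j) //= eqxx mul1r big1 ?addr0 // => i /negbTE ->.
by rewrite mul0r.
Qed.

Let d_pos k j x : is_derive x 'e_j (fun y => pos_part (depth y) ^+ k.+2)
  (- (k.+2%:R * pos_part (depth x) ^+ k.+1 * wall' (x 0 j - c 0 j))).
Proof.
rewrite -mulrN.
exact: is_derive_chain (is_derive_depth j x) (is_derive_pos_partX k (depth x)).
Qed.

Lemma is_derive_bump j x : is_derive x 'e_j bump (bump_grad j x).
Proof. exact: d_pos. Qed.

Lemma is_derive_bump_grad i j x : is_derive x 'e_j (bump_grad i) (bump_hess i j x).
Proof.
have := is_deriveN (is_deriveM (is_deriveZ 3 (d_pos 0 j x)) (d_coord i j x is_derive_wall')).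
have scaleM (a b : R) : a *: b = a * b by [].
congr is_derive; rewrite /bump_hess /= !scaleM.
by ring.
Qed.

Lemma depth_le1 x : depth x <= 1.
Proof. by rewrite gerBl sumr_ge0 // => i _; exact: wall_ge0. Qed.

Lemma bump_ge0 x : 0 <= bump x.
Proof. by rewrite exprn_ge0 // pos_part_ge0. Qed.

Lemma pos_part_depth_le1 x k : 0 <= pos_part (depth x) ^+ k <= 1.
Proof.
rewrite exprn_ge0 ?pos_part_ge0 //= exprn_ile1 ?pos_part_ge0 //.
by rewrite ge_max depth_le1 ler01.
Qed.

Lemma bump_le1 x : bump x <= 1.
Proof. by case/andP: (pos_part_depth_le1 x 3). Qed.

Lemma bump_inside x : cube c rho x ->
  [/\ bump x = 1, forall i, bump_grad i x = 0 & forall i j, bump_hess i j x = 0].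
Proof.
move=> xc; have flat i := wall_flat (xc i).
have d1 : depth x = 1.
  by rewrite /depth big1 ?subr0 // => i _; case: (flat i).
split=> [|i|i j].
- by rewrite /bump d1 pos_part_id // expr1n.
- by rewrite /bump_grad; case: (flat i) => _ -> _; rewrite mulr0 oppr0.
- by rewrite /bump_hess; case: (flat i) => _ -> ->; rewrite !(mulr0, mul0r) subr0.
Qed.

Lemma depth_le0 x i : rho + 1 <= `|x 0 i - c 0 i| -> depth x <= 0.
Proof.
move=> /wall_ge1 w1; rewrite subr_le0 (le_trans w1) // (bigD1 i) //= lerDl.
by rewrite sumr_ge0 // => j _; exact: wall_ge0.
Qed.

Lemma bump_depth_le0 x : depth x <= 0 ->
  [/\ bump x = 0, forall i, bump_grad i x = 0 & forall i j, bump_hess i j x = 0].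
Proof.
move=> /pos_part_eq0 d0.
split=> [|i|i j]; rewrite /bump /bump_grad /bump_hess d0 !expr0n //=.
  by rewrite !(mulr0, mul0r) oppr0.
by rewrite !(mulr0, mul0r) subr0.
Qed.

Lemma bump_outside x : ~ cube c (rho + 1) x -> depth x <= 0.
Proof.
move=> xc; rewrite leNgt; apply/negP => d0; apply: xc => i.
by rewrite leNgt; apply/negP => /ltW /depth_le0; rewrite leNgt d0.
Qed.

(** Off the support everything vanishes.  On it the powers of [depth] are at most
    1 and the derivatives of the walls are at most 3 and 12, whence
    3 * 3 = 9 and 6 * 3 * 3 + 3 * 12 = 90. *)
Lemma bump_derivative_bounds i j x :
  `|bump_grad i x| <= 9 /\ `|bump_hess i j x| <= 90.
Proof.
have [/bump_depth_le0[_ -> ->]|d0] := leP (depth x) 0; first by rewrite normr0.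
have w1 k : wall (x 0 k - c 0 k) <= 1.
  move: d0; rewrite subr_gt0 => /ltW; apply: le_trans.
  by rewrite (bigD1 k) //= lerDl sumr_ge0 // => l _; exact: wall_ge0.
have [a1 b1] := wall_le1_bounds (w1 i); have [a2 _] := wall_le1_bounds (w1 j).
rewrite /bump_grad /bump_hess normrN.
move: (pos_part_depth_le1 x 1) (pos_part_depth_le1 x 2) a1 b1 a2.
move: (_ ^+ 1) (_ ^+ 2) (wall' _) (wall'' _) (wall' _) => p1 p2 u v w.
move=> /andP[p10 p11] /andP[p20 p21] u3 v12 w3; split.
  rewrite !normrM (ger0_norm (ler0n R 3)) (ger0_norm p20).
  by rewrite (_ : 9 = 3 * 1 * 3 :> R) ?ler_pM ?mulr_ge0 //; ring.
rewrite (le_trans (ler_normB _ _)) // (_ : 90 = 54 + 36 :> R); last by ring.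
rewrite !normrM (ger0_norm (ler0n R 6)) (ger0_norm (ler0n R 3)).
rewrite (ger0_norm p10) (ger0_norm p20) (ger0_norm (ler0n R _)) lerD //.
  rewrite (_ : 54 = 6 * 1 * 3 * 3 :> R); last by ring.
  by rewrite !ler_pM ?mulr_ge0.
rewrite (_ : 36 = 1 * (3 * 1 * 12) :> R); last by ring.
rewrite !ler_pM ?mulr_ge0 //.
by case: (_ == _).
Qed.

Let continuous_coord (p : R -> R) i : continuous p ->
  continuous (fun x : 'rV[R]_n => p (x 0 i - c 0 i)).
Proof.
move=> cp x; apply: (@continuous_comp _ _ _ (fun x : 'rV[R]_n => x 0 i - c 0 i) p).
  have hc : {for x, continuous (fun y : 'rV[R]_n => y 0 i)} by exact: coord_continuous.
  by apply: (continuousB hc); exact: (@cst_continuous _ R (c 0 i)).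
exact: cp.
Qed.

Lemma bump_C2 : bounded_C2 bump bump_grad bump_hess.
Proof.
have cwall k a b : continuous (fun s => a * pos_part (s - rho) ^+ k + b * pos_part (- s - rho) ^+ k).
  apply: continuous_funD; apply: continuous_funM; try exact: cst_continuous.
    move=> s; apply: (@continuous_comp _ _ _ (fun s : R => s - rho) (fun t => pos_part t ^+ k)).
      by apply: cvgB; [exact: cvg_id|exact: cvg_cst].
    exact: continuous_pos_partX.
  move=> s; apply: (@continuous_comp _ _ _ (fun s : R => - s - rho) (fun t => pos_part t ^+ k)).
    by apply: cvgB; [apply: cvgN; exact: cvg_id|exact: cvg_cst].
  exact: continuous_pos_partX.
have cdepth : continuous depth.
  apply: continuous_funD; first exact: cst_continuous.
  apply: continuous_funN.
  apply: continuous_fun_sum => i; apply: (continuous_coord (p := wall)).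
  rewrite (_ : wall = fun s => 1 * pos_part (s - rho) ^+ 3 + 1 * pos_part (- s - rho) ^+ 3).
    exact: cwall.
  by apply/funext => s; rewrite !mul1r.
have cw' i : continuous (fun x : 'rV[R]_n => wall' (x 0 i - c 0 i)).
  apply: continuous_coord.
  rewrite (_ : wall' = fun s => 3 * pos_part (s - rho) ^+ 2 + (-3) * pos_part (- s - rho) ^+ 2).
    exact: cwall.
  by apply/funext => s; rewrite mulNr.
have cw'' i : continuous (fun x : 'rV[R]_n => wall'' (x 0 i - c 0 i)).
  by apply: continuous_coord; exact: cwall.
have cp k : continuous (fun x => pos_part (depth x) ^+ k).
  move=> x; apply: (@continuous_comp _ _ _ depth (fun t => pos_part t ^+ k)).
    exact: cdepth.
  exact: continuous_pos_partX.
split.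
- split; first exact: cp.
  by exists 1 => x; rewrite ger0_norm ?bump_ge0 // bump_le1.
- move=> i; split; last by exists 9 => x; have [] := bump_derivative_bounds i i x.
  apply: continuous_funN.
  apply: continuous_funM; last exact: cw'.
  by apply: continuous_funM; [exact: cst_continuous|exact: cp].
- move=> i j; split; last by exists 90 => x; have [] := bump_derivative_bounds i j x.
  apply: continuous_funD.
    apply: continuous_funM; last exact: cw'.
    apply: continuous_funM; last exact: cw'.
    by apply: continuous_funM; [exact: cst_continuous|exact: cp].
  apply: continuous_funN.
  apply: continuous_funM; first exact: cst_continuous.
  apply: continuous_funM; last exact: cw''.
  by apply: continuous_funM; [exact: cst_continuous|exact: cp].
- by move=> i x; exact: is_derive_bump.
- by move=> i j x; exact: is_derive_bump_grad.
Qed.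

End bump.

(** * Energy integrals of the plateau function *)

Section bump_energy.
Context (R : realType) (n : nat) (alpha : R).
Hypothesis alpha_lt0 : alpha < 0.
Local Notation mu := (lebesgue_rV R n).

(** An upper bound for the integrand of Q between the two cubes, where the
    Laplacian is at most 90 n and the function lies between 0 and 1. *)
Definition shell_bound : R := (n%:R * 90 + 1) ^+ 2 - alpha.

Variables (G : set 'rV[R]_n) (mG : measurable G).
Hypothesis Goo : (mu G < +oo)%E.

Lemma integrable_cube (c : 'rV[R]_n) (s a : R) :
  mu.-integrable G (EFin \o (fun x => a * \1_(cube c s) x)).
Proof.
apply: measurable_bounded_integrable => //.
  by apply: measurable_funM => //; apply: measurable_indic; exact: measurable_cube.
exists `|a|; split; first exact: num_real.
move=> y ay x _; apply: le_trans (ltW ay).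
by rewrite normrM indicE; case: (_ \in _); rewrite ?normr1 ?mulr1 // normr0 mulr0.
Qed.

Lemma Rintegral_cube (c : 'rV[R]_n) (s a : R) : 0 <= s -> cube c s `<=` G ->
  \int[mu]_(x in G) (a * \1_(cube c s) x) = a * (2 * s) ^+ n.
Proof.
move=> s0 cG; rewrite RintegralZl //; last first.
  have := integrable_cube c s 1.
  by under [fun x => 1 * _]eq_fun do rewrite mul1r.
rewrite /Rintegral integral_indic //; last exact: measurable_cube.
by have /= := lebesgue_cube c s0; rewrite setIidl // => ->.
Qed.

Variables (c : 'rV[R]_n) (rho : R).
Hypotheses (rho_ge0 : 0 <= rho) (cG : cube c (rho + 1) `<=` G).
Local Notation inner := ((2 * rho) ^+ n).
Local Notation outer := ((2 * (rho + 1)) ^+ n).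
Local Notation u := (bump c rho).

Let inner_sub : cube c rho `<=` cube c (rho + 1).
Proof. by move=> x xc i; rewrite (le_trans (xc i)) // lerDl. Qed.

Let rho1_ge0 : 0 <= rho + 1. Proof. by rewrite addr_ge0. Qed.

Let bu : bounded_continuous u := bC2_fun (bump_C2 c rho).

Let integrableX m : mu.-integrable G (EFin \o (fun x => u x ^+ m)).
Proof. by apply: bounded_continuous_integrable => //; exact: bounded_continuousX. Qed.


Lemma bump_intpow_ge m : inner <= \int[mu]_(x in G) u x ^+ m.
Proof.
rewrite -[inner]mul1r -(@Rintegral_cube c rho 1) //; last by move=> x /inner_sub /cG.
apply: le_Rintegral => //; first exact: (integrable_cube c rho 1).
move=> x _; rewrite mul1r indicE; case: (boolP (x \in cube c rho)) => /= [|_]; last first.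
  by rewrite exprn_ge0 // bump_ge0.
by rewrite inE => /bump_inside[-> _ _]; rewrite expr1n.
Qed.

Lemma bump_intpow_le m : (0 < m)%N -> \int[mu]_(x in G) u x ^+ m <= outer.
Proof.
move=> m0; rewrite -[outer]mul1r -(@Rintegral_cube c (rho + 1) 1) //.
apply: le_Rintegral => //; first exact: (integrable_cube c (rho + 1) 1).
move=> x _; rewrite mul1r indicE; case: (boolP (x \in _)) => [_|/negP xc] /=.
  by rewrite exprn_ile1 ?bump_ge0 ?bump_le1.
have /bump_depth_le0[-> _ _] : depth c rho x <= 0.
  by apply: bump_outside => xc'; apply: xc; rewrite inE.
by rewrite expr0n eqn0Ngt m0.
Qed.

Let integrand x := (\sum_i bump_hess c rho i i x + u x) ^+ 2 - alpha * u x ^+ 2.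

Let integrable_integrand : mu.-integrable G (EFin \o integrand).
Proof.
apply: bounded_continuous_integrable => //.
apply: bounded_continuousD.
  apply: bounded_continuousX; apply: bounded_continuousD => //.
  by apply: bounded_continuous_sum => i; exact: (bC2_hess (bump_C2 c rho)).
under eq_fun do rewrite -mulNr.
by apply: bounded_continuousM; [exact: bounded_continuous_cst|exact: bounded_continuousX].
Qed.

Lemma bump_Qf_ge : - alpha * inner <= C2_Qf alpha G u (bump_hess c rho).
Proof.
rewrite -(@Rintegral_cube c rho (- alpha)) //; last by move=> x /inner_sub /cG.
apply: le_Rintegral => //; first exact: (integrable_cube c rho (- alpha)).
move=> x _; rewrite indicE; case: (boolP (x \in _)) => [|_].
  rewrite inE => /bump_inside[-> _ _]; rewrite expr1n mulr1 mulr1.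
  by rewrite lerDr sqr_ge0.
by rewrite mulr0 addr_ge0 ?sqr_ge0 // -mulNr mulr_ge0 ?sqr_ge0 // oppr_ge0 ltW.
Qed.

(** On the inner cube the integrand is that of the constant 1. *)
Lemma bump_Qf_le : C2_Qf alpha G u (bump_hess c rho) <=
  (1 - alpha) * inner + shell_bound * (outer - inner).
Proof.
have -> : (1 - alpha) * inner + shell_bound * (outer - inner) =
  shell_bound * outer + (1 - alpha - shell_bound) * inner by ring.
rewrite -(@Rintegral_cube c (rho + 1)) // -(@Rintegral_cube c rho) //; last by move=> x /inner_sub /cG.
rewrite -RintegralD //; [|exact: integrable_cube c (rho + 1) shell_bound|exact: integrable_cube c rho (1 - alpha - shell_bound)].
apply: le_Rintegral => //.
  have := integrableD mG (integrable_cube c (rho + 1) shell_bound)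
    (integrable_cube c rho (1 - alpha - shell_bound)).
  by [].
move=> x _; rewrite !indicE.
case: (boolP (x \in cube c rho)) => [|_].
  rewrite inE => xc; have -> : x \in cube c (rho + 1) by rewrite inE; exact: inner_sub.
  have [-> _ hx] := bump_inside xc.
  by rewrite big1 // add0r !expr1n !mulr1; lra.
rewrite mulr0 addr0; case: (boolP (x \in _)) => [_|/negP xc] /=; last first.
  have /bump_depth_le0[-> _ hx] : depth c rho x <= 0.
    by apply: bump_outside => xc'; apply: xc; rewrite inE.
  by rewrite big1 // add0r expr0n /= !mulr0 subr0.
rewrite mulr1 lerB //.
  rewrite -[leLHS]real_normK ?num_real // ler_pXn2r ?nnegrE ?addr_ge0 ?mulr_ge0 //.
  rewrite (le_trans (ler_normD _ _)) // lerD //; last first.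
    by rewrite ger0_norm ?bump_ge0 // bump_le1.
  rewrite (le_trans (ler_norm_sum _ _ _)) //.
  rewrite (_ : n%:R * 90 = \sum_(i < n) 90 :> R); last first.
    by rewrite sumr_const card_ord mulr_natl.
  by apply: ler_sum => i _; have [] := bump_derivative_bounds c rho i i x.
rewrite -[leLHS]mulr1 ler_wnM2l ?(ltW alpha_lt0) //.
by rewrite exprn_ile1 ?bump_ge0 ?bump_le1.
Qed.

(** A frontier point of an open set lies outside it, hence outside the outer cube
    by a positive margin in some coordinate; within that margin the gradient
    vanishes. *)
Lemma bump_flat_near_frontier x : open G -> frontier G x ->
  exists2 e : R, 0 < e &
    forall y, G y -> eball x e y -> forall i, bump_grad c rho i y = 0.
Proof.
rewrite interior_id => oG [_]; rewrite oG => Gx.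
have : ~ cube c (rho + 1) x by move/cG.
move=> /existsNP[i /negP]; rewrite -ltNge => xi.
exists (`|x 0 i - c 0 i| - (rho + 1)); first by rewrite subr_gt0.
move=> y _; rewrite /eball /= => xy j.
have yx : `|y 0 i - x 0 i| < `|x 0 i - c 0 i| - (rho + 1).
  rewrite -(@ltr_pXn2r _ 2) ?nnegrE ?subr_ge0 ?(ltW xi) // real_normK ?num_real //.
  apply: le_lt_trans xy; rewrite /dotv (bigD1 i) //= !mxE -expr2 lerDl.
  by apply: sumr_ge0 => k _; rewrite -expr2 sqr_ge0.
have /bump_depth_le0[_ -> _] // : depth c rho y <= 0.
apply: (@depth_le0 _ _ _ _ _ i).
have := ler_distD (y 0 i) (x 0 i) (c 0 i).
by rewrite (distrC (x 0 i) (y 0 i)); lra.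
Qed.

End bump_energy.

(** This is 4 Q I4 <= b I3^2 with the bounds for the plateau function.  Divided by
    the squared volume of the inner cube, the left side is a polynomial in the
    volume ratio y = (1 + 1 / rho)^n with value 4 a at y = 1, and y tends to 1 as
    rho grows. *)
Lemma plateau_ratio (R : realType) (n : nat) (a b K : R) : 4 * a < b ->
  exists2 rho : R, 0 < rho &
    4 * (a * (2 * rho) ^+ n + K * ((2 * (rho + 1)) ^+ n - (2 * rho) ^+ n))
      * (2 * (rho + 1)) ^+ n <= b * ((2 * rho) ^+ n) ^+ 2.
Proof.
move=> ab.
pose phi (y : R) := 4 * (a + K * (y - 1)) * y.
have cphi : continuous (fun e : R => phi ((1 + e) ^+ n)).
  have ce : continuous (fun e : R => (1 + e) ^+ n).
    move=> e; apply: (@continuous_comp _ _ _ (fun e : R => 1 + e) (fun t => t ^+ n)).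
      by apply: cvgD; [exact: cvg_cst|exact: cvg_id].
    exact: exprn_continuous.
  apply: continuous_funM => //; apply: continuous_funM; first exact: cst_continuous.
  apply: continuous_funD; first exact: cst_continuous.
  apply: continuous_funM; first exact: cst_continuous.
  by apply: continuous_funD => //; exact: cst_continuous.
have phi0 : phi ((1 + 0) ^+ n) < b by rewrite /phi addr0 expr1n subrr mulr0 addr0 mulr1.
have : \forall e \near (0 : R)^'+, phi ((1 + e) ^+ n) < b.
  have := cvg_at_right_filter (cphi 0); move=> /cvgr_lt; exact.
move=> near0.
(* rho will be 1 / e, so that the volume ratio is (1 + e)^n. *)
have [e [e0 eb]] : exists e : R, 0 < e /\ phi ((1 + e) ^+ n) < b.
  near (0 : R)^'+ => e; exists e; split; near: e => //.
  exact: nbhs_right_gt.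
exists e^-1; first by rewrite invr_gt0.
have -> : (2 * (e^-1 + 1)) ^+ n = (1 + e) ^+ n * (2 * e^-1) ^+ n.
  by rewrite -exprMn; congr (_ ^+ _); field; rewrite gt_eqF.
move: eb; rewrite /phi; move: ((1 + e) ^+ n) ((2 * e^-1) ^+ n) => y A yb.
rewrite (_ : _ * _ = 4 * (a + K * (y - 1)) * y * A ^+ 2); last by ring.
by rewrite ler_wpM2r ?sqr_ge0 // ltW.
Unshelve. all: by end_near. Qed.

(** * Dilated polyhedra and the uniform bound *)

Section polyhedra.
Context (R : realType) (n : nat).
Implicit Types (G : set 'rV[R]_n).

Lemma polyhedron_open G : bounded_convex_polyhedron G -> open G.
Proof.
move=> [[k [a [b ->]]] _ _].
have oi i : open [set x | dotv (a i) x < b i].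
  have cdot : continuous (dotv (a i)).
    apply: continuous_fun_sum => j; apply: continuous_funM; first exact: cst_continuous.
    exact: coord_continuous.
  by move/continuousP: cdot => /(_ _ (open_lt (y := b i))).
rewrite openE => x Px; apply: (@filter_forall _ 'I_k (fun i => [set x | dotv (a i) x < b i]) (nbhs x) (nbhs_filter x)) => i.
by apply: open_nbhs_nbhs; split; [exact: oi|exact: Px].
Qed.

Lemma dilateE r G : r != 0 -> dilate r G = ( *:%R r^-1) @^-1` G.
Proof.
move=> r0; apply/seteqP; split=> [_ [x Gx <-]|x Gx].
  by rewrite /preimage /= scalerA mulVf // scale1r.
by exists (r^-1 *: x) => //; rewrite scalerA mulfV // scale1r.
Qed.

Lemma open_dilate r G : r != 0 -> open G -> open (dilate r G).
Proof.
move=> r0 oG; rewrite dilateE //.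
by apply: open_comp oG => x _; exact: scaler_continuous.
Qed.

Lemma dilate_sub_cube r s G : 0 <= r -> G `<=` cube 0 s ->
  dilate r G `<=` cube 0 (r * s).
Proof.
move=> r0 Gs _ [x /Gs xs <-] i; have := xs i.
by rewrite !mxE !subr0 normrM (ger0_norm r0) => /ler_wpM2l; exact.
Qed.

Lemma cube_sub_dilate r s (x : 'rV[R]_n) G : 0 < r -> cube x s `<=` G ->
  cube (r *: x) (r * s) `<=` dilate r G.
Proof.
move=> r0 xG; rewrite dilateE ?gt_eqF // => y yx; apply: xG => i.
have := yx i; rewrite !mxE => yxi.
rewrite -(ler_pM2l r0); apply: le_trans yxi.
by rewrite -{1}(gtr0_norm r0) -normrM mulrBr mulrA mulfV ?gt_eqF // mul1r.
Qed.

Lemma open_contains_cube G (x : 'rV[R]_n) : open G -> G x ->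
  exists2 s : R, 0 < s & cube x s `<=` G.
Proof.
move=> oG Gx; have /nbhs_ballP[e /= e0 eG] := open_nbhs_nbhs (conj oG Gx).
exists (e / 2); first by rewrite divr_gt0.
move=> y yx; apply: eG; apply/rV_ballP => // i.
by rewrite distrC (le_lt_trans (yx i)) // ltr_pdivrMr // ltr_pMr // ltr1n.
Qed.

Lemma lebesgue_sub_cube G (s : R) : 0 <= s -> measurable G -> G `<=` cube 0 s ->
  (lebesgue_rV R n G < +oo)%E /\ fine (lebesgue_rV R n G) <= (2 * s) ^+ n.
Proof.
move=> s0 mG Gs.
have le : (lebesgue_rV R n G <= ((2 * s) ^+ n)%:E)%E.
  rewrite -(lebesgue_cube 0 s0); apply: le_measure => //; rewrite inE //.
  exact: measurable_cube.
have fin : (lebesgue_rV R n G < +oo)%E by apply: le_lt_trans le _; rewrite ltry.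
by split=> //; rewrite -lee_fin fineK // ge0_fin_numE.
Qed.

(** The supremum is bounded below by its entry for dilation 1, and [beta0] by the
    first entry of its maximum. *)
Lemma sqrt_lt_of_beta_star (alpha beta : R) G :
  (beta_star alpha G < beta%:E)%E -> 2 * Num.sqrt (1 - alpha) < beta.
Proof.
move=> bs.
have b0 : beta0 alpha (dilate 1 G) < beta.
  rewrite -lte_fin; apply: le_lt_trans bs.
  by apply: ereal_sup_ubound; exists 1 => //=.
apply: le_lt_trans b0.
by rewrite ler_pM2l // le_max lexx.
Qed.

(** For the constant 1 the condition 4 Q I4 <= beta^2 I3^2 reads
    4 (1 - alpha) <= beta^2. *)
Lemma constant_on_ridge (alpha beta : R) G : 0 < beta -> alpha < 0 ->
  4 * (1 - alpha) <= beta ^+ 2 -> measurable G ->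
  (lebesgue_rV R n G < +oo)%E -> 0 < fine (lebesgue_rV R n G) ->
  exists2 v : sobolev22 G, ridge_nehari_set alpha beta v &
    Ef alpha beta v <=
      4 / 3 * ((1 - alpha) ^+ 3 / beta ^+ 2 * fine (lebesgue_rV R n G)).
Proof.
move=> b0 a0 ab mG Goo V0; set V := fine _ in V0 *.
have I m : \int[lebesgue_rV R n]_(x in G) (1 : R) ^+ m = V.
  by under eq_Rintegral do rewrite expr1n; rewrite Rintegral_cst // mul1r.
have Q : C2_Qf alpha G (fun=> 1) (fun _ _ _ => 0) = (1 - alpha) * V.
  rewrite /C2_Qf -Rintegral_cst //; apply: eq_Rintegral => x _.
  by rewrite big1 // add0r !expr1n mulr1.
have a1 : 0 < 1 - alpha by lra.
have [|||||v vR vE] := @ray_meets_ridge R n alpha beta G _ _ _ mG Goo (bounded_C2_cst n 1) _ b0.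
- by move=> x _; exists 1.
- by rewrite Q mulr_gt0.
- by rewrite I.
- by rewrite I.
- rewrite Q !I (_ : _ * V = 4 * (1 - alpha) * V ^+ 2); last by ring.
  by rewrite ler_wpM2r // sqr_ge0.
exists v => //; apply: le_trans vE _; rewrite Q I le_eqVlt; apply/orP; left; apply/eqP.
by field; rewrite !gt_eqF.
Qed.

(** The bound depends on rho and the parameters, but neither on G nor on the
    position c of the plateau. *)
Lemma bump_on_ridge (alpha beta rho : R) G (c : 'rV[R]_n) : 0 < beta -> alpha < 0 ->
  let A := (2 * rho) ^+ n in
  let q := (1 - alpha) * A + shell_bound n alpha * ((2 * (rho + 1)) ^+ n - A) in
  0 < rho -> 4 * q * (2 * (rho + 1)) ^+ n <= beta ^+ 2 * A ^+ 2 ->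
  open G -> measurable G -> (lebesgue_rV R n G < +oo)%E ->
  cube c (rho + 1) `<=` G ->
  exists2 v : sobolev22 G, ridge_nehari_set alpha beta v &
    Ef alpha beta v <= 4 / 3 * (q ^+ 3 / (beta ^+ 2 * A ^+ 2)).
Proof.
move=> b0 a0 A q rho0 disc oG mG Goo cG.
have r0 := ltW rho0.
have A0 : 0 < A by rewrite exprn_gt0 // mulr_gt0.
have i3 := bump_intpow_ge mG Goo r0 cG 3.
have i4 := bump_intpow_ge mG Goo r0 cG 4.
have i4' := @bump_intpow_le _ _ _ mG Goo _ _ r0 cG 4 isT.
have q0 := bump_Qf_ge a0 mG Goo r0 cG.
have q1 := bump_Qf_le a0 mG Goo r0 cG.
rewrite -/A in i3 i4 q0 q1; rewrite -/q in q1.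
have Q0 : 0 < C2_Qf alpha G (bump c rho) (bump_hess c rho).
  by apply: lt_le_trans q0; rewrite mulr_gt0 // oppr_gt0.
have bA : beta ^+ 2 * A ^+ 2 <= beta ^+ 2 * (\int[lebesgue_rV R n]_(x in G) bump c rho x ^+ 3) ^+ 2.
  by rewrite ler_wpM2l ?sqr_ge0 // ler_pXn2r // nnegrE ltW // (lt_le_trans A0).
have [||||v vR vE] := @ray_meets_ridge R n alpha beta G _ _ _ mG Goo (bump_C2 c rho) _ b0 Q0.
- by move=> x; exact: bump_flat_near_frontier.
- exact: lt_le_trans i3.
- exact: lt_le_trans i4.
- apply: le_trans bA; apply: le_trans disc.
  rewrite ler_pM ?mulr_ge0 ?(ltW Q0) ?ler_wpM2l //.
  by apply: le_trans i4; rewrite ltW.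
exists v => //; apply: le_trans vE _.
rewrite ler_wpM2l ?divr_ge0 //.
have bA0 : 0 < beta ^+ 2 * A ^+ 2 by rewrite mulr_gt0 // exprn_gt0.
rewrite ler_pM ?exprn_ge0 ?(ltW Q0) ?invr_ge0 //.
- by rewrite (le_trans (ltW bA0)).
- by rewrite ler_pXn2r // nnegrE ?ltW // (lt_le_trans Q0).
- by rewrite lef_pV2 // posrE // (lt_le_trans bA0).
Qed.

End polyhedra.

Theorem lemma3p11 (R : realType) (n : nat) (n_ge1 : (1 <= n)%N)
    (n_le7 : (n <= 7)%N) (Omega : set 'rV[R]_n)
    (Omega_poly : bounded_convex_polyhedron Omega)
    (alpha beta : R) (alpha_lt0 : alpha < 0)
    (beta_gt : (beta_star alpha Omega < beta%:E)%E) :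
  exists C : R, forall (r : R) (U : sobolev22 (dilate r Omega)),
    1 <= r -> ridge_nehari_solution alpha beta U -> `|Ef alpha beta U| <= C.
Proof.
have sb := sqrt_lt_of_beta_star beta_gt.
have a1 : 0 < 1 - alpha by lra.
have b0 : 0 < beta by apply: le_lt_trans sb; rewrite mulr_ge0.
have ab : 4 * (1 - alpha) < beta ^+ 2.
  rewrite -[ltLHS](_ : (2 * Num.sqrt (1 - alpha)) ^+ 2 = _).
    by rewrite ltr_pXn2r // nnegrE ?(ltW b0) // mulr_ge0.
  by rewrite exprMn sqr_sqrtr ?(ltW a1) // expr2; ring.
have oOmega := polyhedron_open Omega_poly.
have [_ bOmega [x0 Ox0]] := Omega_poly.
have [S S0 OS] := bounded_sub_cube bOmega.
have [delta delta0 Odelta] := open_contains_cube oOmega Ox0.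
have [rho rho0 plateau] := plateau_ratio n (shell_bound n alpha) ab.
(* From this dilation factor on, the dilated domain has room for the plateau. *)
pose r0 := (rho + 1) / delta.
have r00 : 0 < r0 by rewrite divr_gt0 // addr_gt0.
pose A := (2 * rho) ^+ n.
pose q := (1 - alpha) * A + shell_bound n alpha * ((2 * (rho + 1)) ^+ n - A).
pose C1 := 4 / 3 * (q ^+ 3 / (beta ^+ 2 * A ^+ 2)).
pose C2 := 4 / 3 * ((1 - alpha) ^+ 3 / beta ^+ 2 * (2 * (r0 * S)) ^+ n).
exists (Num.max C1 C2) => r U r1 [Uridge Umin].
rewrite ger0_norm ?Ef_ridge_ge0 // le_max.
have rgt0 : 0 < r by exact: lt_le_trans r1.
have oG : open (dilate r Omega) by apply: open_dilate; rewrite ?gt_eqF.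
have mG := open_measurable_rV oG.
have GS := dilate_sub_cube (ltW rgt0) OS.
have [Goo Vle] := lebesgue_sub_cube (mulr_ge0 (ltW rgt0) S0) mG GS.
have cG := cube_sub_dilate rgt0 Odelta.
have [rr0|rr0] := leP r0 r; apply/orP; [left|right].
  have cG' : cube (r *: x0) (rho + 1) `<=` dilate r Omega.
    move=> y yc; apply: cG => i; rewrite (le_trans (yc i)) //.
    by rewrite -ler_pdivrMr.
  have [v vridge] := bump_on_ridge b0 alpha_lt0 rho0 plateau oG mG Goo cG'.
  by apply: le_trans; exact: Umin.
have V0 : 0 < fine (lebesgue_rV R n (dilate r Omega)).
  have rd : 0 < r * delta by exact: mulr_gt0.
  have : (lebesgue_rV R n (cube (r *: x0) (r * delta)) <= lebesgue_rV R n (dilate r Omega))%E.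
    by apply: le_measure => //; rewrite inE //; exact: measurable_cube.
  have /= -> := lebesgue_cube (r *: x0) (ltW rd).
  rewrite -[X in (_ <= X)%E]fineK ?ge0_fin_numE // lee_fin.
  by apply: lt_le_trans; rewrite exprn_gt0 // mulr_gt0.
have [v vridge] := constant_on_ridge b0 alpha_lt0 (ltW ab) mG Goo V0.
move=> vE; apply: le_trans (Umin v vridge) _; apply: le_trans vE _.
rewrite /C2 ler_wpM2l ?divr_ge0 //.
rewrite ler_wpM2l ?divr_ge0 ?exprn_ge0 ?(ltW a1) ?(ltW b0) //.
apply: le_trans Vle _.
have rS0 : 0 <= 2 * (r * S) by rewrite !mulr_ge0 // ltW.
have r0S0 : 0 <= 2 * (r0 * S) := mulr_ge0 (ler0n R 2) (mulr_ge0 (ltW r00) S0).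
by rewrite lerXn2r // ler_wpM2l // ler_wpM2r // ltW.
Qed.
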